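(* Let the FIE cost function satisfy Assumption A1 stated in the context, and suppose that: a) the system $x_{t+1}=f(x_t,w_t)$, $y_t=h(x_t)+v_t$ is exp-i-IOSS with functions $\beta\in\mathcal{KL}$, $\alpha_1,\alpha_2\in\mathcal K$, where $\beta(s,t)=c_1s^{a_1}b_1^{t}$ for some constants $c_1,a_1>0$ and $0<b_1<1$ and all $s,t\ge0$; b) the sub-cost function $V_{t,1}$ is $V_{t,1}(\chi_0-\bar x_0)=c_2|\chi_0-\bar x_0|^{a_2}b_2^{t}$ with $c_2,a_2>0$ and $0<b_2<1$ (so that $\underline\rho_x(s,t)=\rho_x(s,t)=c_2s^{a_2}b_2^{t}$); and c) $\sqrt[a_2]{b_2}\ge\sqrt[a_1]{b_1}$. Let $\eta\in(0,1)$ and $M_0,M_w,M_v\ge0$. Then there exist $\bar\beta_x\in\mathcal{KL}$ and $\bar\alpha_w,\bar\alpha_v\in\mathcal K$ satisfying the inequality of Assumption A2 stated in the context such that, with $\bar s$ the resulting constant defined in the context, the following holds: if $$c_1\left[3\left(1+\sqrt[a_2]{3}\right)\right]^{a_1}s^{a_1}b_1^{T_{\eta,\bar s}}+\alpha_1\left(3\underline\gamma_w^{-1}\left(3c_2s^{a_2}b_2^{T_{\eta,\bar s}}\right)\right)+\alpha_2\left(3\underline\gamma_v^{-1}\left(3c_2s^{a_2}b_2^{T_{\eta,\bar s}}\right)\right)\le\eta s$$ for all $s\in[0,\bar s]$, then $$\bar\beta_x(s,T_{\eta,\bar s})+\alpha_1\left(3\underline\gamma_w^{-1}\left(3\rho_x(s,T_{\eta,\bar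 s})\right)\right)+\alpha_2\left(3\underline\gamma_v^{-1}\left(3\rho_x(s,T_{\eta,\bar s})\right)\right)\le\eta s$$ for all $s\in[0,\bar s]$.
   Context: Notation. $\mathbb I_{\ge0}$ is the set of nonnegative integers, $\mathbb I_{a:b}$ the integers from $a$ to $b$; for discrete times, $t\ge0$ and $t\in\mathbb I_{\ge0}$ are used interchangeably; $T_{\eta,\bar s}\in\mathbb I_{\ge0}$ is a horizon size. $|\cdot|$ is the Euclidean norm. $\boldsymbol x_{a:b}$ denotes $\{x_a,\dots,x_b\}$, $h(\boldsymbol x_{a:b})=\{h(x_a),\dots,h(x_b)\}$, and $\|\boldsymbol x_{a:b}\|:=\max_{a\le i\le b}|x_i|$ if $a\le b$, $0$ if $a>b$. $\alpha:\mathbb R_{\ge0}\to\mathbb R_{\ge0}$ is a $\mathcal K$ function if continuous, zero at zero and strictly increasing, and $\mathcal K_\infty$ if moreover $\alpha(s)\to\infty$ as $s\to\infty$. $\varphi:\mathbb R_{\ge0}\to\mathbb R_{\ge0}$ is an $\mathcal L$ function if continuous, nonincreasing and $\varphi(t)\to0$ as $t\to\infty$. $\beta:\mathbb R_{\ge0}^2\to\mathbb R_{\ge0}$ is a $\mathcal{KL}$ function if $\beta(\cdot,t)\in\mathcal K$ for each $t\ge0$ and $\beta(s,\cdot)\in\mathcal L$ for each $s\ge0$. System. $x_{t+1}=f(x_t,w_t)$, $y_t=h(x_t)+v_t$, $x_t\in\mathbb R^n$, $y_t,v_t\in\mathbb R^p$, $w_t\in\mathbb R^g$, $f,h$ continuous.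 It is i-IOSS if there exist $\beta\in\mathcal{KL}$, $\alpha_1,\alpha_2\in\mathcal K$ such that for all initial states $x_0^{(1)},x_0^{(2)}$ and disturbance sequences $\boldsymbol w^{(1)}_{0:t-1},\boldsymbol w^{(2)}_{0:t-1}$, with corresponding states $x_t^{(i)}$ of $x_{t+1}=f(x_t,w_t)$, for all $t\in\mathbb I_{\ge0}$: $|x_t^{(1)}-x_t^{(2)}|\le\beta(|x_0^{(1)}-x_0^{(2)}|,t)+\alpha_1(\|\boldsymbol w^{(1)}_{0:t-1}-\boldsymbol w^{(2)}_{0:t-1}\|)+\alpha_2(\|h(\boldsymbol x^{(1)}_{0:t})-h(\boldsymbol x^{(2)}_{0:t})\|)$. It is exp-i-IOSS if this holds with $\beta(s,t)=\alpha(s)a^t$ for some $\alpha\in\mathcal K$ and constant $a\in(0,1)$. Full information estimation (FIE) minimizes a cost $V_t(\chi_0-\bar x_0,\boldsymbol\omega_{0:t-1},\boldsymbol\nu_{0:t})$ over initial states $\chi_0\in\mathbb B_x^0$, disturbances $\boldsymbol\omega_{0:t-1}\in\mathbb B_w^{0:t-1}$ and noises $\boldsymbol\nu_{0:t}\in\mathbb B_v^{0:t}$ (given bounded sets) subject to $\chi_{\tau+1}=f(\chi_\tau,\omega_\tau)$ and $y_\tau=h(\chi_\tau)+\nu_\tau$; $\bar x_0$ is a prior estimate of $x_0$. Assumption A1. $V_t=V_{t,1}(\chi_0-\bar x_0)+V_{t,2}(\boldsymbol\omega_{0:t-1},\boldsymbol\nu_{0:t})$ with $V_{t,1},V_{t,2}$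 continuous and, for all $\chi_0\in\mathbb B_x^0$, $\boldsymbol\omega_{0:t-1}\in\mathbb B_w^{0:t-1}$, $\boldsymbol\nu_{0:t}\in\mathbb B_v^{0:t}$, $t\in\mathbb I_{\ge0}$: $\underline\rho_x(|\chi_0-\bar x_0|,t)\le V_{t,1}(\chi_0-\bar x_0)\le\rho_x(|\chi_0-\bar x_0|,t)$ and $\underline\gamma_w(\|\boldsymbol\omega_{0:t-1}\|)+\underline\gamma_v(\|\boldsymbol\nu_{0:t}\|)\le V_{t,2}(\boldsymbol\omega_{0:t-1},\boldsymbol\nu_{0:t})\le\gamma_w(\|\boldsymbol\omega_{0:t-1}\|)+\gamma_v(\|\boldsymbol\nu_{0:t}\|)$, where $\underline\rho_x,\rho_x\in\mathcal{KL}$ and $\underline\gamma_w,\underline\gamma_v,\gamma_w,\gamma_v\in\mathcal K_\infty$. Assumption A2 (inequality). For all $s_x,s_w,s_v,t\ge0$: $\beta\left(s_x+\underline\rho_x^{-1}\left(\rho_x(s_x,t)+\gamma_w(s_w)+\gamma_v(s_v),t\right),t\right)\le\bar\beta_x(s_x,t)+\bar\alpha_w(s_w)+\bar\alpha_v(s_v)$, where $\underline\rho_x^{-1}(\cdot,t)$ is the inverse of $\underline\rho_x(\cdot,t)$ in its first argument at time $t$. Constant $\bar s$. $M_0,M_w,M_v$ are bounds with $|x_0-\bar x_0|\le M_0$, $|w_t|\le M_w$, $|v_t|\le M_v$ for all $t$, and $\bar s:=\beta_x(M_0,0)+\frac1{1-\eta}(\alpha_w(M_w)+\alpha_v(M_v))$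 with $\beta_x(s,t)=\bar\beta_x(s,t)+\alpha_1(3\underline\gamma_w^{-1}(3\rho_x(s,t)))+\alpha_2(3\underline\gamma_v^{-1}(3\rho_x(s,t)))$, $\alpha_w(s)=\bar\alpha_w(s)+\alpha_1(3s+3\underline\gamma_w^{-1}(3\gamma_w(s)))+\alpha_2(3\underline\gamma_v^{-1}(3\gamma_w(s)))$, $\alpha_v(s)=\bar\alpha_v(s)+\alpha_1(3\underline\gamma_w^{-1}(3\gamma_v(s)))+\alpha_2(3s+3\underline\gamma_v^{-1}(3\gamma_v(s)))$. *)

(* Defs.v *)
From mathcomp Require Import all_boot all_order all_algebra.
From mathcomp Require Import all_classical all_reals all_analysis.

Set Implicit Arguments.
Unset Strict Implicit.
Unset Printing Implicit Defensive.

Import Order.TTheory GRing.Theory Num.Theory.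
Import numFieldNormedType.Exports.

Local Open Scope classical_set_scope.
Local Open Scope ring_scope.

(* Functions of nonnegative reals are total functions [R -> R]; only their
   values on [0, +oo[ are constrained. *)
Section ComparisonFunctions.
Context {R : realType}.
Implicit Types (a phi : R -> R) (beta : R -> R -> R).

Definition class_K a : Prop :=
  [/\ {homo a : s / 0 <= s},
      {within `[0, +oo[, continuous a},
      a 0 = 0 &
      forall s s' : R, 0 <= s -> s < s' -> a s < a s'].

Definition class_Kinf a : Prop :=
  class_K a /\ a s @[s --> +oo] --> +oo.

Definition class_L phi : Prop :=
  [/\ {homo phi : t / 0 <= t},
      {within `[0, +oo[, continuous phi},
      forall t t' : R, 0 <= t -> t <= t' -> phi t' <= phi t &
      phi t @[t --> +oo] --> 0].

Definition class_KL beta : Prop :=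
  (forall t : R, 0 <= t -> class_K (fun s => beta s t)) /\
  (forall s : R, 0 <= s -> class_L (fun t => beta s t)).

(* A genuine two-sided inverse on [0, +oo[ when [a] is of class K_oo. *)
Definition inv_nneg a : R -> R := 'pinv_(fun=> 0 : R) `[0, +oo[ a.

End ComparisonFunctions.

(* A finite sequence of [m] vectors of R^d is the matrix of type
   ['M[R]_(m, d)] whose rows are its terms. *)
Section Sequences.
Context {R : realType}.

(* The norm of the library on matrices is the max norm, hence this one. *)
Definition enorm {d : nat} (x : 'rV[R]_d) : R :=
  Num.sqrt (\sum_(i < d) x 0 i ^+ 2).

Definition segment {d : nat} (m : nat) (z : nat -> 'rV[R]_d) : 'M[R]_(m, d) :=
  \matrix_(i < m) z i.

(* Equal to 0 on the empty sequence. *)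
Definition seqnorm {m d : nat} (z : 'M[R]_(m, d)) : R :=
  \big[Num.max/0]_(i < m) enorm (row i z).

End Sequences.

Section System.
Context {R : realType} {n p g : nat}.
Variables (f : 'rV[R]_n -> 'rV[R]_g -> 'rV[R]_n) (h : 'rV[R]_n -> 'rV[R]_p).

Definition is_trajectory (x : nat -> 'rV[R]_n) (w : nat -> 'rV[R]_g) : Prop :=
  forall t, x t.+1 = f (x t) (w t).

(* The sequence [w_{0:t-1}] is [segment t w] and [h(x_{0:t})] is
   [segment t.+1 (h \o x)]. *)
Definition iIOSS_with (beta : R -> R -> R) (alpha1 alpha2 : R -> R) : Prop :=
  [/\ class_KL beta, class_K alpha1, class_K alpha2 &
      forall (x1 x2 : nat -> 'rV[R]_n) (w1 w2 : nat -> 'rV[R]_g),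
        is_trajectory x1 w1 -> is_trajectory x2 w2 ->
        forall t : nat,
          enorm (x1 t - x2 t) <=
            beta (enorm (x1 0%N - x2 0%N)) t%:R
            + alpha1 (seqnorm (segment t w1 - segment t w2))
            + alpha2 (seqnorm (segment t.+1 (h \o x1)
                               - segment t.+1 (h \o x2)))].

Definition exp_iIOSS_with (beta : R -> R -> R) (alpha1 alpha2 : R -> R) : Prop :=
  iIOSS_with beta alpha1 alpha2 /\
  exists (alpha : R -> R) (a : R),
    [/\ class_K alpha, 0 < a < 1 &
        forall s t : R, 0 <= s -> 0 <= t -> beta s t = alpha s * a `^ t].

End System.

Section FIE.
Context {R : realType} {n p g : nat}.

(* [V t], [V1 t], [V2 t] are the cost and its two sub-costs at time [t];
   [Bx], [Bw t], [Bv t] are the constraint sets of the initial state, of the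
   disturbances at times 0, ..., t-1 and of the noises at times 0, ..., t. *)
Record fie_cost_bounds
    (xbar0 : 'rV[R]_n)
    (Bx : set 'rV[R]_n)
    (Bw : forall t : nat, set 'M[R]_(t, g))
    (Bv : forall t : nat, set 'M[R]_(t.+1, p))
    (V : forall t : nat, 'rV[R]_n -> 'M[R]_(t, g) -> 'M[R]_(t.+1, p) -> R)
    (V1 : nat -> 'rV[R]_n -> R)
    (V2 : forall t : nat, 'M[R]_(t, g) -> 'M[R]_(t.+1, p) -> R)
    (rho_lo rho : R -> R -> R)
    (gammaw_lo gammav_lo gammaw gammav : R -> R) : Prop := FIECostBounds {
  cost_split : forall t z omega nu, V t z omega nu = V1 t z + V2 t omega nu;
  cost1_continuous : forall t, continuous (V1 t);
  cost2_continuous : forall t,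
    continuous (fun u : 'M[R]_(t, g) * 'M[R]_(t.+1, p) => V2 t u.1 u.2);
  rho_lo_KL : class_KL rho_lo;
  rho_KL : class_KL rho;
  gammaw_lo_Kinf : class_Kinf gammaw_lo;
  gammav_lo_Kinf : class_Kinf gammav_lo;
  gammaw_Kinf : class_Kinf gammaw;
  gammav_Kinf : class_Kinf gammav;
  cost1_bounds : forall t chi0, Bx chi0 ->
    rho_lo (enorm (chi0 - xbar0)) t%:R <= V1 t (chi0 - xbar0)
      <= rho (enorm (chi0 - xbar0)) t%:R;
  cost2_bounds : forall t omega nu, Bw t omega -> Bv t nu ->
    gammaw_lo (seqnorm omega) + gammav_lo (seqnorm nu) <= V2 t omega nu
      <= gammaw (seqnorm omega) + gammav (seqnorm nu)
}.

Definition fie_gain_inequality (beta rho_lo rho : R -> R -> R)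
    (gammaw gammav : R -> R)
    (betabarx : R -> R -> R) (alphabarw alphabarv : R -> R) : Prop :=
  forall sx sw sv t : R, 0 <= sx -> 0 <= sw -> 0 <= sv -> 0 <= t ->
    beta (sx + inv_nneg (fun s => rho_lo s t)
                 (rho sx t + gammaw sw + gammav sv)) t
    <= betabarx sx t + alphabarw sw + alphabarv sv.

Definition betax (alpha1 alpha2 : R -> R) (rho : R -> R -> R)
    (gammaw_lo gammav_lo : R -> R) (betabarx : R -> R -> R) (s t : R) : R :=
  betabarx s t
  + alpha1 (3 * inv_nneg gammaw_lo (3 * rho s t))
  + alpha2 (3 * inv_nneg gammav_lo (3 * rho s t)).

Definition alphaw (alpha1 alpha2 gammaw_lo gammav_lo gammaw : R -> R)
    (alphabarw : R -> R) (s : R) : R :=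
  alphabarw s
  + alpha1 (3 * s + 3 * inv_nneg gammaw_lo (3 * gammaw s))
  + alpha2 (3 * inv_nneg gammav_lo (3 * gammaw s)).

Definition alphav (alpha1 alpha2 gammaw_lo gammav_lo gammav : R -> R)
    (alphabarv : R -> R) (s : R) : R :=
  alphabarv s
  + alpha1 (3 * inv_nneg gammaw_lo (3 * gammav s))
  + alpha2 (3 * s + 3 * inv_nneg gammav_lo (3 * gammav s)).

Definition sbar (alpha1 alpha2 : R -> R) (rho : R -> R -> R)
    (gammaw_lo gammav_lo gammaw gammav : R -> R)
    (betabarx : R -> R -> R) (alphabarw alphabarv : R -> R)
    (eta M0 Mw Mv : R) : R :=
  betax alpha1 alpha2 rho gammaw_lo gammav_lo betabarx M0 0
  + 1 / (1 - eta)
    * (alphaw alpha1 alpha2 gammaw_lo gammav_lo gammaw alphabarw Mw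
       + alphav alpha1 alpha2 gammaw_lo gammav_lo gammav alphabarv Mv).

End FIE.

(* Main.v *)
Require Import Defs.
From mathcomp Require Import all_boot all_order all_algebra.
From mathcomp Require Import all_classical all_reals all_analysis.
From mathcomp Require Import ring lra.
Import Order.TTheory GRing.Theory Num.Theory.
Import numFieldNormedType.Exports.
Local Open Scope classical_set_scope.
Local Open Scope ring_scope.

(** With r := 1/a2, the inverse of rho_lo(., t) at y is (y / (c2 b2^t))^r.
    Bounding the power of a sum of three terms by the sum of the powers of their
    triples, once with exponent r and once with exponent a1, splits
    beta(s_x + rho_lo^-1(...), t) into c1 (3 (1 + 3^r) s_x)^a1 b1^t and two terms
    c1 (3 (3 gamma(s) / c2)^r)^a1 (b1^(1/a1) / b2^r)^(a1 t). Condition c) makes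
    the last factor at most 1, so these terms are bounded by class K functions of
    s alone, and the first term is the one in the hypothesis on T. *)

Section ClassK.
Context {R : realType}.
Implicit Types (a b : R -> R) (beta : R -> R -> R).

Lemma class_K_comp a b : class_K a -> class_K b -> class_K (a \o b).
Proof.
move=> [a_ge0 a_cont a0 a_mono] [b_ge0 b_cont b0 b_mono]; split.
- by move=> s s0; apply/a_ge0/b_ge0.
- apply/subspace_continuousP => x x_ge0.
  have {}x_ge0 : 0 <= x by move: x_ge0; rewrite /= in_itv /= andbT.
  have bx : `[0, +oo[%classic (b x) by rewrite /= in_itv /= andbT b_ge0.
  move/subspace_continuousP/(_ _ bx): a_cont => a_cont.
  (* Continuity of [a] at [b x] is relative to the half-line, so [b] must converge inside it; this
     holds because [b] maps the half-line into itself. *)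
  apply: (cvg_comp _ _ _ a_cont).
  have /subspace_continuousP/(_ x) := b_cont.
  rewrite /= in_itv /= andbT => /(_ x_ge0) b_cvg P bP.
  have := b_cvg _ bP; rewrite !nbhs_filterE /= /within /=.
  apply: filterS => y By y0; apply: By => //.
  by move: y0; rewrite !in_itv /= !andbT; exact: b_ge0.
- by rewrite /= b0 a0.
- by move=> s s' s0 ss'; apply: a_mono; [exact: b_ge0|exact: b_mono].
Qed.

Lemma class_K_powR (r : R) : 0 < r -> class_K (fun s : R => s `^ r).
Proof.
move=> r0; split.
- by move=> s _; exact: powR_ge0.
(* Derivability gives continuity at positive points; at 0 the one-sided limit is treated
   separately. *)
- apply/continuous_within_itvcyP; split.
    move=> x x0; apply: differentiable_continuous.
    exact/derivable1_diffP/derivable_powR.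
  by rewrite powR0 ?gt_eqF//; exact: powR_cvg0.
- by rewrite powR0 ?gt_eqF.
- move=> s s' s0 ss'; apply: gt0_ltr_powR => //; rewrite nnegrE//.
  exact/ltW/(le_lt_trans s0).
Qed.

Lemma class_K_scale (k : R) : 0 < k -> class_K ( *%R k).
Proof.
move=> k0; split.
- by move=> s s0; rewrite mulr_ge0// ltW.
- by apply: continuous_subspaceT; exact: mulrl_continuous.
- by rewrite mulr0.
- by move=> s s' _; rewrite ltr_pM2l.
Qed.

Lemma class_KL_comp beta a :
  class_KL beta -> class_K a -> class_KL (fun s t => beta (a s) t).
Proof.
move=> [beta_K beta_L] Ka; split=> [t t0|s s0].
- exact: (class_K_comp _ _ (beta_K _ t0) Ka).
- by apply: beta_L; case: Ka => + _ _ _; exact.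
Qed.

Lemma inv_nnegK a x :
  {in Num.nneg &, injective a} -> 0 <= x -> inv_nneg a (a x) = x.
Proof.
move=> a_inj x0; rewrite /inv_nneg pinvKV//.
  move=> y z; rewrite !inE /= !in_itv /= !andbT => y0 z0.
  by apply: a_inj; rewrite nnegrE.
by rewrite inE /= in_itv /= x0.
Qed.

End ClassK.

(** The sum is at most three times its largest term, and the power of that triple is one of the
    nonnegative summands on the right. This covers concave and convex powers alike. *)
Lemma powR_add3_le (R : realType) (x y z r : R) :
  0 <= x -> 0 <= y -> 0 <= z -> 0 <= r ->
  (x + y + z) `^ r <= (3 * x) `^ r + (3 * y) `^ r + (3 * z) `^ r.
Proof.
move=> x0 y0 z0 r0.
have bound u : 0 <= u -> x <= u -> y <= u -> z <= u ->
    (x + y + z) `^ r <= (3 * u) `^ r.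
  by move=> u0 xu yu zu; apply: ge0_ler_powR => //; rewrite ?nnegrE; lra.
have px := powR_ge0 (3 * x) r.
have py := powR_ge0 (3 * y) r.
have pz := powR_ge0 (3 * z) r.
have [xy|yx] := leP x y.
  have [yz|zy] := leP y z.
    by have := bound z z0 (le_trans xy yz) yz (lexx _); lra.
  by have := bound y y0 xy (lexx _) (ltW zy); lra.
have [xz|zx] := leP x z.
  by have := bound z z0 xz (ltW (lt_le_trans yx xz)) (lexx _); lra.
by have := bound x x0 (lexx _) (ltW yx) (ltW zx); lra.
Qed.

(** The right-hand side is an explicit nonnegative preimage of [y], and [b] is injective on the
    half-line, so the partial inverse returns it. *)
Lemma inv_nneg_powR (R : realType) (b : R -> R) (c a y : R) :
  0 < c -> 0 < a -> 0 <= y -> (forall s, 0 <= s -> b s = c * s `^ a) ->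
  inv_nneg b y = (y / c) `^ a^-1.
Proof.
move=> c0 a0 y0 bE.
have yc : 0 <= y / c by rewrite divr_ge0// ltW.
rewrite -[in LHS](_ : b ((y / c) `^ a^-1) = y); last first.
  by rewrite bE ?powR_ge0// -powRrM mulVf ?gt_eqF// powRr1// mulrC divfK ?gt_eqF.
apply: inv_nnegK; last exact: powR_ge0.
move=> s s' s0 s0'; rewrite !bE -?nnegrE// => /(mulfI _) E.
by apply: (powR_injective a0) => //; apply: E; rewrite gt_eqF.
Qed.

Lemma discount_le1 (R : realType) (a1 b1 r b2 t : R) :
  0 < a1 -> 0 < b1 -> 0 < b2 -> b1 `^ a1^-1 <= b2 `^ r -> 0 <= t ->
  ((b2 `^ t)^-1 `^ r) `^ a1 * b1 `^ t <= 1.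
Proof.
move=> a10 b10 b20 b12 t0.
(* Both factors become powers with exponents t and then a1, so monotonicity reduces the claim to the
   comparison of the bases in condition c). *)
have -> : b1 `^ t = ((b1 `^ a1^-1) `^ t) `^ a1.
  by rewrite [RHS]powRAC -(powRrM b1) mulVf ?gt_eqF// powRr1// ltW.
have powRV (x y : R) : 0 <= x -> x^-1 `^ y = (x `^ y)^-1.
  by move=> x0; rewrite -(powR_inv1 x0) powRAC powR_inv1 ?powR_ge0.
rewrite (powRV (b2 `^ t)) ?powR_ge0// (powRAC b2) powRV ?powR_ge0//.
rewrite mulrC ler_pdivrMr ?powR_gt0// mul1r.
apply: ge0_ler_powR; rewrite ?nnegrE ?powR_ge0 ?(ltW a10)//.
by apply: ge0_ler_powR; rewrite ?nnegrE ?powR_ge0.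
Qed.

Lemma gain_split (R : realType) (c1 a1 b1 c2 a2 b2 sx gw gv t : R) :
  0 < c1 -> 0 < a1 -> 0 < b1 -> 0 < c2 -> 0 < a2 -> 0 < b2 ->
  b1 `^ a1^-1 <= b2 `^ a2^-1 ->
  0 <= sx -> 0 <= gw -> 0 <= gv -> 0 <= t ->
  c1 * (sx + ((c2 * sx `^ a2 * b2 `^ t + gw + gv)
              / (c2 * b2 `^ t)) `^ a2^-1) `^ a1 * b1 `^ t
  <= c1 * (3 * (1 + 3 `^ a2^-1) * sx) `^ a1 * b1 `^ t
     + c1 * (3 * (3 / c2 * gw) `^ a2^-1) `^ a1
     + c1 * (3 * (3 / c2 * gv) `^ a2^-1) `^ a1.
Proof.
move=> c10 a10 b10 c20 a20 b20 b12 sx0 gw0 gv0 t0.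
have := discount_le1 _ _ _ a2^-1 _ _ a10 b10 b20 b12 t0.
set r := a2^-1; set q := (b2 `^ t)^-1 => disc.
have r0 : 0 <= r by rewrite invr_ge0 ltW.
have bt0 : 0 < b2 `^ t by rewrite powR_gt0.
have q0 : 0 <= q by rewrite invr_ge0 ltW.
have c2V0 : 0 <= c2^-1 by rewrite invr_ge0 ltW.
have -> : (c2 * sx `^ a2 * b2 `^ t + gw + gv) / (c2 * b2 `^ t)
    = sx `^ a2 + gw / c2 * q + gv / c2 * q.
  by rewrite /q; field; rewrite !gt_eqF.
(* First splitting, with exponent r: since r a2 = 1, the state term is linear in [sx], while the
   other two keep the growing factor q^r. *)
have inner : (sx `^ a2 + gw / c2 * q + gv / c2 * q) `^ r
    <= 3 `^ r * sx + (3 / c2 * gw) `^ r * q `^ r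
       + (3 / c2 * gv) `^ r * q `^ r.
  have -> : 3 `^ r * sx = (3 * sx `^ a2) `^ r.
    by rewrite powRM ?powR_ge0// -powRrM divff ?gt_eqF// powRr1.
  have E u : 0 <= u -> (3 / c2 * u) `^ r * q `^ r = (3 * (u / c2 * q)) `^ r.
    move=> u0; rewrite -powRM ?mulr_ge0//.
    by congr (_ `^ _); ring.
  by rewrite !E//; apply: powR_add3_le; rewrite ?powR_ge0 ?mulr_ge0.
(* Second splitting, with exponent a1: the outer [sx] merges with the 3^r sx from [inner], so three
   terms remain, and this gives the constant 1 + 3^r. *)
have outer : (sx + (sx `^ a2 + gw / c2 * q + gv / c2 * q) `^ r) `^ a1
    <= (3 * (1 + 3 `^ r) * sx) `^ a1
       + (3 * (3 / c2 * gw) `^ r) `^ a1 * q `^ r `^ a1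
       + (3 * (3 / c2 * gv) `^ r) `^ a1 * q `^ r `^ a1.
  have := @powR_add3_le R ((1 + 3 `^ r) * sx) ((3 / c2 * gw) `^ r * q `^ r)
    ((3 / c2 * gv) `^ r * q `^ r) a1.
  rewrite !mulr_ge0 ?addr_ge0 ?powR_ge0 ?(ltW a10)//.
  move=> /(_ isT isT isT isT); rewrite !mulrA.
  rewrite ![(_ * q `^ r) `^ a1]powRM ?mulr_ge0 ?powR_ge0//.
  apply: le_trans; apply: ge0_ler_powR;
    rewrite ?nnegrE ?addr_ge0 ?mulr_ge0 ?addr_ge0 ?powR_ge0 ?(ltW a10)//.
  by move: inner; rewrite mulrDl mul1r; lra.
(* The decay b1^t absorbs the growth of q^r by [disc], which removes the time dependence from the
   gamma terms. *)
have cut u : c1 * (u `^ a1 * q `^ r `^ a1) * b1 `^ t <= c1 * u `^ a1.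
  by rewrite -!mulrA ler_pM2l// ler_piMr ?powR_ge0.
apply: (@le_trans _ _ (c1 * ((3 * (1 + 3 `^ r) * sx) `^ a1
       + (3 * (3 / c2 * gw) `^ r) `^ a1 * q `^ r `^ a1
       + (3 * (3 / c2 * gv) `^ r) `^ a1 * q `^ r `^ a1) * b1 `^ t)).
  by rewrite ler_pM2r ?powR_gt0// ler_pM2l.
by rewrite 2!mulrDr 2!mulrDl !lerD.
Qed.

Theorem lemma9 (R : realType) (n p g : nat)
  (f : 'rV[R]_n -> 'rV[R]_g -> 'rV[R]_n) (h : 'rV[R]_n -> 'rV[R]_p)
  (hf : continuous (fun u : 'rV[R]_n * 'rV[R]_g => f u.1 u.2))
  (hh : continuous h)
  (xbar0 : 'rV[R]_n)
  (Bx : set 'rV[R]_n)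
  (Bw : forall t : nat, set 'M[R]_(t, g))
  (Bv : forall t : nat, set 'M[R]_(t.+1, p))
  (hBx : bounded_set Bx)
  (hBw : forall t, bounded_set (Bw t))
  (hBv : forall t, bounded_set (Bv t))
  (V : forall t : nat, 'rV[R]_n -> 'M[R]_(t, g) -> 'M[R]_(t.+1, p) -> R)
  (V1 : nat -> 'rV[R]_n -> R)
  (V2 : forall t : nat, 'M[R]_(t, g) -> 'M[R]_(t.+1, p) -> R)
  (rho_lo rho : R -> R -> R)
  (gammaw_lo gammav_lo gammaw gammav : R -> R)
  (hV : fie_cost_bounds xbar0 Bx Bw Bv V V1 V2 rho_lo rho
          gammaw_lo gammav_lo gammaw gammav)
  (beta : R -> R -> R) (alpha1 alpha2 : R -> R)
  (hioss : exp_iIOSS_with f h beta alpha1 alpha2)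
  (c1 a1 b1 : R) (hc1 : 0 < c1) (ha1 : 0 < a1) (hb1 : 0 < b1 < 1)
  (hbeta : forall s t : R, 0 <= s -> 0 <= t -> beta s t = c1 * s `^ a1 * b1 `^ t)
  (c2 a2 b2 : R) (hc2 : 0 < c2) (ha2 : 0 < a2) (hb2 : 0 < b2 < 1)
  (hV1 : forall (t : nat) (chi0 : 'rV[R]_n),
     V1 t (chi0 - xbar0) = c2 * enorm (chi0 - xbar0) `^ a2 * b2 ^+ t)
  (hrho_lo : forall s t : R, 0 <= s -> 0 <= t ->
     rho_lo s t = c2 * s `^ a2 * b2 `^ t)
  (hrho : forall s t : R, 0 <= s -> 0 <= t -> rho s t = c2 * s `^ a2 * b2 `^ t)
  (hb : b2 `^ a2^-1 >= b1 `^ a1^-1)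
  (eta M0 Mw Mv : R) (heta : 0 < eta < 1)
  (hM0 : 0 <= M0) (hMw : 0 <= Mw) (hMv : 0 <= Mv) :
  exists (betabarx : R -> R -> R) (alphabarw alphabarv : R -> R),
    [/\ class_KL betabarx, class_K alphabarw, class_K alphabarv,
        fie_gain_inequality beta rho_lo rho gammaw gammav
          betabarx alphabarw alphabarv &
        let sb := sbar alpha1 alpha2 rho gammaw_lo gammav_lo gammaw gammav
                   betabarx alphabarw alphabarv eta M0 Mw Mv in
        forall T : nat,
          (forall s : R, 0 <= s <= sb ->
             c1 * (3 * (1 + 3 `^ a2^-1)) `^ a1 * s `^ a1 * b1 ^+ T
             + alpha1 (3 * inv_nneg gammaw_lo (3 * (c2 * s `^ a2 * b2 ^+ T)))
             + alpha2 (3 * inv_nneg gammav_lo (3 * (c2 * s `^ a2 * b2 ^+ T)))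
             <= eta * s) ->
          forall s : R, 0 <= s <= sb ->
            betabarx s T%:R
            + alpha1 (3 * inv_nneg gammaw_lo (3 * rho s T%:R))
            + alpha2 (3 * inv_nneg gammav_lo (3 * rho s T%:R))
            <= eta * s].
Proof.
have /andP[b10 _] := hb1; have /andP[b20 _] := hb2.
have [[beta_KL _ _ _] _] := hioss.
have [_ _ _ _ _ _ _ [gw_K _] [gv_K _] _ _] := hV.
have r0 : 0 < a2^-1 by rewrite invr_gt0.
have K0 : 0 < 3 * (1 + 3 `^ a2^-1) :> R.
  by rewrite mulr_gt0// ltr_wpDr ?powR_ge0.
have bar_K a : class_K a ->
    class_K (fun s => beta (3 * (3 / c2 * a s) `^ a2^-1) 0).
  move=> Ka; have [beta_K _] := beta_KL.
  have c0 : 0 < 3 / c2 by rewrite divr_gt0.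
  have /class_K_comp :=
    class_K_comp _ _ (class_K_scale 3 (ltr0Sn R 2)) (class_K_powR _ r0).
  move=> /(_ _ (class_K_comp _ _ (class_K_scale _ c0) Ka)).
  exact: (class_K_comp _ _ (beta_K 0 (lexx 0))).
exists (fun s t => beta (3 * (1 + 3 `^ a2^-1) * s) t).
(* At time 0 the factor b1^t is 1, so this is the time-free term of [gain_split], and its class K
   property comes from that of beta(., 0). *)
exists (fun s => beta (3 * (3 / c2 * gammaw s) `^ a2^-1) 0).
exists (fun s => beta (3 * (3 / c2 * gammav s) `^ a2^-1) 0).
split; [|exact: bar_K|exact: bar_K| |].
- exact: (class_KL_comp _ _ beta_KL (class_K_scale _ K0)).
- move=> sx sw sv t sx0 sw0 sv0 t0.
  have gw0 : 0 <= gammaw sw by case: gw_K => + _ _ _; exact.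
  have gv0 : 0 <= gammav sv by case: gv_K => + _ _ _; exact.
  (* At fixed t, rho_lo(., t) is a pure power with coefficient c2 b2^t. *)
  rewrite (inv_nneg_powR _ _ (c2 * b2 `^ t) a2) ?hrho//; first last.
  + by move=> s s0; rewrite hrho_lo// mulrAC.
  + by rewrite !addr_ge0// !mulr_ge0 ?powR_ge0 ?ltW.
  + by rewrite mulr_gt0 ?powR_gt0.
  have beta0 u : 0 <= u -> beta u 0 = c1 * u `^ a1.
    by move=> u0; rewrite hbeta// powRr0 mulr1.
  rewrite beta0 ?mulr_ge0 ?powR_ge0// beta0 ?mulr_ge0 ?powR_ge0//.
  rewrite !hbeta ?addr_ge0 ?mulr_ge0 ?powR_ge0 ?(ltW K0)//.
  exact: gain_split.
- move=> sb T hT s hs; have /andP[s0 _] := hs.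
  rewrite hbeta ?mulr_ge0 ?(ltW K0)// hrho// !powR_mulrn ?(ltW b10, ltW b20)//.
  by rewrite powRM ?(ltW K0)// (mulrA c1); exact: hT.
Qed.
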